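(* Let $X$ be a locally compact space. Then $$\mu\big(\mathcal T^*(X)\big)=\big\{C\in\mathcal Z(\beta X): C\cap X=\emptyset\big\}\setminus\{\emptyset\}.$$
   Context: Locally compact spaces and compact spaces are assumed Hausdorff. For a Tychonoff space $X$, a one-point extension of $X$ is a Tychonoff space $Y$ containing $X$ as a dense subspace such that $Y\setminus X$ is a singleton; we write $Y=X\cup\{p\}$. Two extensions are identified if there is a homeomorphism between them fixing $X$ pointwise. $\mathcal T(X)$ is the set of all (equivalence classes of) one-point extensions of $X$, and $\mathcal T^*(X)=\{Y=X\cup\{p\}\in\mathcal T(X): Y\text{ is first countable at }p\}$. $\beta X$ is the Stone-Čech compactification of $X$, and $\mathcal Z(T)$ is the set of all zero-sets of a space $T$. For $Y=X\cup\{p\}\in\mathcal T(X)$, $F_Y:\beta X\to\beta Y$ is the unique continuous function with $F_Y|X=\mathrm{id}_X$, and $\mu(Y)=F_Y^{-1}(p)$, a non-empty closed subset of $\beta X\setminus X$. *)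

(* Defs.v *)
From HB Require Import structures.
From mathcomp Require Import all_boot all_order all_algebra.
From mathcomp Require Import all_classical all_reals all_analysis.

Set Implicit Arguments.
Unset Strict Implicit.
Unset Printing Implicit Defensive.

Import Order.TTheory GRing.Theory Num.Theory.
Import numFieldNormedType.Exports.

Local Open Scope classical_set_scope.
Local Open Scope ring_scope.

Definition tychonoff_space (T : topologicalType) :=
  completely_regular_space T /\ hausdorff_space T.

Definition topological_embedding (T U : topologicalType) (f : T -> U) :=
  injective f /\ forall A : set T, open A <-> exists2 B, open B & A = f @^-1` B.

Definition homeomorphism (T U : topologicalType) (h : T -> U) :=
  continuous h /\ exists g : U -> T, [/\ continuous g, cancel h g & cancel g h].

Definition first_countable_at (T : topologicalType) (p : T) :=
  exists B : set_system T,
    [/\ countable B, B `<=` nbhs p &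
        forall U, nbhs p U -> exists2 V, B V & V `<=` U].

Definition zero_set (R : realType) (T : topologicalType) (A : set T) :=
  exists2 f : T -> R, continuous f & A = f @^-1` [set 0].

Lemma topological_embedding_continuous (T U : topologicalType) (f : T -> U) :
  topological_embedding f -> continuous f.
Proof. by case=> _ fo; apply/continuousP => A oA; apply/fo; exists A. Qed.

Lemma eq_continuous_dense (S T U : topologicalType) (e : S -> T)
    (f g : T -> U) :
  hausdorff_space U -> dense (range e) -> continuous f -> continuous g ->
  (forall x, f (e x) = g (e x)) -> f = g.
Proof.
move=> hU de cf cg fg; apply/funext => z; apply: hU => A B fA gB.
have : nbhs z (f @^-1` A `&` g @^-1` B).
  by apply: filterI; [exact: cf|exact: cg].
rewrite nbhsE => -[V [oV Vz] VAB].
have [_ [/[swap] -[x _ <-] /VAB [fx gx]]] : V `&` range e !=set0.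
  by apply: de => //; exists z.
exists (f (e x)); split => //.
by rewrite fg.
Qed.

(* The Stone-Cech compactification of a Tychonoff space T is the closure of the
   canonical image of T in the cube [0, 1]^C(T, [0, 1]); the cube is taken here
   as a subset of the product of copies of R. *)
Section StoneCech.
Variable R : realType.
Implicit Types S T U : topologicalType.

Definition unit_functions T : set (T -> R) :=
  [set f : T -> R | continuous f /\ forall x, 0 <= f x <= 1].

Arguments unit_functions : clear implicits.

Definition cube T := prod_topology (fun _ : unit_functions T => R).

Definition cube_eval T (x : T) : cube T := fun f => set_val f x.

Definition beta_set T : set (cube T) := closure (range (@cube_eval T)).

Arguments beta_set : clear implicits.

Definition beta T : Type := set_type (beta_set T).

HB.instance Definition _ T :=
  Topological.copy (beta T) (set_type (beta_set T)).

Fact beta_in_subproof T (x : T) : cube_eval x \in beta_set T.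
Proof. by apply/mem_set; apply: subset_closure; exists x. Qed.

Definition beta_in T (x : T) : beta T :=
  exist (fun z => z \in beta_set T) _ (beta_in_subproof x).

Lemma cube_continuous S T (g : S -> cube T) :
  (forall i, continuous (g^~ i)) -> continuous g.
Proof.
move=> cg x; apply/cvg_sup => i.
move=> A /= [B [[C oC CB] Bx] BA].
apply: (filterS (P := g^~ i @^-1` C)).
  by move=> y Cy; apply: BA; rewrite -CB.
by apply: cg; apply: open_nbhs_nbhs; split => //; move: Bx; rewrite -CB.
Qed.

Lemma cube_proj_continuous T i : continuous (fun z : cube T => z i).
Proof. exact: (@proj_continuous _ (fun _ : unit_functions T => R)). Qed.

Lemma cube_eval_continuous T : continuous (@cube_eval T).
Proof.
apply: cube_continuous => i; rewrite /cube_eval.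
by have [] := set_mem (valP i).
Qed.

Lemma beta_val_continuous T : continuous (set_val : beta T -> cube T).
Proof. exact: initial_continuous. Qed.

Lemma beta_coord_continuous T (i : unit_functions T) :
  continuous (fun z : beta T => set_val z i : R).
Proof.
move=> z; apply: (@continuous_comp _ _ _ set_val (fun w : cube T => w i)).
  exact: beta_val_continuous.
exact: cube_proj_continuous.
Qed.

Lemma continuous_beta S T (g : S -> beta T) :
  continuous (set_val \o g) -> continuous g.
Proof. exact: continuous_comp_initial. Qed.

Lemma beta_in_continuous T : continuous (@beta_in T).
Proof. by apply: continuous_beta; exact: cube_eval_continuous. Qed.

Lemma cube_hausdorff T : hausdorff_space (cube T).
Proof. by apply: hausdorff_product => ?; exact: Rhausdorff. Qed.

Lemma beta_hausdorff T : hausdorff_space (beta T).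
Proof.
move=> z w zw; apply: val_inj; apply: cube_hausdorff => A B zA wB.
have nA : nbhs z (set_val @^-1` A) by exact: (@beta_val_continuous T).
have nB : nbhs w (set_val @^-1` B) by exact: (@beta_val_continuous T).
by have [v [Av Bv]] := zw _ _ nA nB; exists (set_val v).
Qed.

Lemma beta_set_compact T : compact (beta_set T).
Proof.
pose K : set (cube T) := [set z | forall i, `[0, 1]%classic (z i)].
have cK : compact K.
  apply: (@tychonoff (unit_functions T) (fun=> R) (fun=> `[0, 1]%classic)) => _.
  exact: segment_compact.
have Kcl : closed K by apply: compact_closed => //; exact: cube_hausdorff.
apply: (subclosed_compact _ cK); first exact: closed_closure.
rewrite [X in _ `<=` X](iffLR (closure_id K) Kcl); apply: closureS.
move=> _ [x _ <-] i /=; rewrite in_itv /=.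
by have [_] := set_mem (valP i); exact.
Qed.

Lemma beta_compact T : compact [set: beta T].
Proof.
move=> F FF _.
pose v : beta T -> cube T := set_val.
have bF : (v @ F) (beta_set T).
  apply: (@filterS _ F _ setT); [|exact: filterT]; move=> z _ /=.
  exact: set_mem (svalP z).
have [p [bp pF]] := @beta_set_compact T (v @ F) _ bF.
exists (exist (fun z => z \in beta_set T) p (mem_set bp)); split => // A B FA.
move=> [C [[D oD DC] Cp] CB].
have nA : (v @ F) (v @` A) by apply: (@filterS _ F _ A) FA => z Az; exists z.
have nD : nbhs p D.
  by apply: open_nbhs_nbhs; split => //; move: Cp; rewrite -DC.
have [_ [[z Az <-] Dz]] := pF _ _ nA nD.
by exists z; split => //; apply: CB; rewrite -DC.
Qed.

Lemma beta_in_dense T : dense (range (@beta_in T)).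
Proof.
move=> A [z Az] [B oB BA].
have /(_ B) [] : beta_set T (set_val z) by exact: set_mem (svalP z).
  by apply: open_nbhs_nbhs; split => //; move: Az; rewrite -BA.
move=> _ [[x _ <-] Bx]; exists (beta_in x); split; last by exists x.
by rewrite -BA.
Qed.

Lemma beta_in_embedding T :
  tychonoff_space T -> topological_embedding (@beta_in T).
Proof.
move=> [crT hT].
have sep (A : set T) x : closed A -> ~ A x ->
    exists i : unit_functions T,
      set_val i x = 0 /\ forall y, A y -> set_val i y = 1.
  move=> cA nAx.
  have /(@uniform_separatorP T R)[f [cf f01 f0 f1]] := crT _ _ cA nAx.
  have fP : f \in unit_functions T.
    apply/mem_set; split => // y.
    by have := f01 (f y); rewrite /= in_itv; apply; exists y.
  exists (exist (fun g => g \in unit_functions T) f fP).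
  split; first by apply: f0; exists x.
  by move=> y Ay; apply: f1; exists y.
split=> [x y|A].
  move=> /(congr1 val) /= xy; apply: contrapT => nxy.
  have cy : closed [set y].
    by apply: accessible_closed_set1; exact: hausdorff_accessible.
  have [//|i [ix iy]] := sep _ x cy.
  have := congr1 (fun z => z i) xy; rewrite /cube_eval ix iy // => /eqP.
  by rewrite eq_sym oner_eq0.
split=> [oA|[B oB ->]]; last first.
  by apply: open_comp => // ? _; exact: beta_in_continuous.
pose BB := [set V : set (beta T) | open V /\ @beta_in T @^-1` V `<=` A].
pose B := \bigcup_(V in BB) V.
exists B; first by apply: bigcup_open => V [].
apply/seteqP; split=> [x Ax|x [V [_ VA] /VA]]//.
have [|//|i [ix iA]] := sep (~` A) x; first exact: open_closedC.
exists ([set z : beta T | set_val z i < 1]); last first.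
  by change (set_val i x < 1); rewrite ix.
split.
  apply: (@open_comp _ _ (fun z : beta T => set_val z i) [set r | r < 1]).
    by move=> z _; exact: beta_coord_continuous.
  exact: open_lt.
move=> y; change (set_val i y < 1 -> A y) => yi.
by apply: contrapT => /iA iy; move: yi; rewrite iy ltxx.
Qed.

Fact pull_subproof S T (f : S -> T) :
  continuous f -> forall i : unit_functions T,
  set_val i \o f \in unit_functions S.
Proof.
move=> cf i; have [ci i01] := set_mem (valP i).
apply/mem_set; split => [x|x]; last exact: i01.
by apply: continuous_comp; [exact: cf|exact: ci].
Qed.

Definition pull S T (f : S -> T) (cf : continuous f) (i : unit_functions T) :
  unit_functions S := 
  exist (fun g => g \in unit_functions S) _ (pull_subproof cf i).

Fact beta_map_subproof S T (f : S -> T) (cf : continuous f) (z : beta S) :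
  (fun i => set_val z (pull cf i)) \in beta_set T.
Proof.
apply/mem_set.
pose g (w : cube S) : cube T := fun i => w (pull cf i).
have cg : continuous g.
  by apply: cube_continuous => i; exact: cube_proj_continuous.
move=> A gA.
have : beta_set S (set_val z) by exact: set_mem (svalP z).
move=> /(_ (g @^-1` A)) [|_ [[x _ <-] Ax]]; first exact: cg.
by exists (g (cube_eval x)); split => //; exists (f x).
Qed.

Definition beta_map S T (f : S -> T) (cf : continuous f) (z : beta S) :
    beta T :=
  exist (fun w => w \in beta_set T) _ (beta_map_subproof cf z).

Lemma beta_map_continuous S T (f : S -> T) (cf : continuous f) :
  continuous (beta_map cf).
Proof.
apply: continuous_beta; apply: cube_continuous => i.
exact: (@beta_coord_continuous S (pull cf i)).
Qed.

Lemma beta_map_in S T (f : S -> T) (cf : continuous f) x :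
  beta_map cf (beta_in x) = beta_in (f x).
Proof. exact: val_inj. Qed.

Lemma beta_map_unique S T (f : S -> T) (cf : continuous f)
    (g : beta S -> beta T) :
  continuous g -> (forall x, g (beta_in x) = beta_in (f x)) -> g = beta_map cf.
Proof.
move=> cg gf.
apply: (eq_continuous_dense (@beta_hausdorff T) (@beta_in_dense S)) => //.
  exact: beta_map_continuous.
by move=> x; rewrite gf beta_map_in.
Qed.

Lemma beta_universal T U (f : T -> U) :
  compact [set: U] -> hausdorff_space U -> continuous f ->
  exists2 g : beta T -> U, continuous g & forall x, g (beta_in x) = f x.
Proof.
move=> cU hU cf.
have tU : tychonoff_space U.
  split => //; apply: (@normal_completely_regular R); last first.
    exact: hausdorff_accessible.
  exact: compact_normal.
have [ji jo] := beta_in_embedding tU.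
have surj : range (@beta_in U) = setT.
  have : closed (range (@beta_in U)).
    apply: compact_closed; first exact: beta_hausdorff.
    apply: continuous_compact => //; apply: continuous_subspaceT.
    exact: beta_in_continuous.
  move=> /closed_openC oC; apply/seteqP; split => // z _; apply: contrapT => nz.
  by have [w []] := @beta_in_dense U _ (ex_intro _ z nz) oC.
have inv z : exists u, @beta_in U u = z.
  have [u _ <-] : range (@beta_in U) z by rewrite surj.
  by exists u.
pose k z := projT1 (cid (inv z)).
have kK z : beta_in (k z) = z by exact: (projT2 (cid (inv z))).
exists (k \o beta_map cf); last first.
  by move=> x /=; apply: ji; rewrite kK beta_map_in.
have ck : continuous k.
  apply/continuousP => A /jo [B oB ->].
  suff -> : k @^-1` (@beta_in U @^-1` B) = B by [].
  by apply/seteqP; split => z /=; rewrite kK.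
by move=> z; apply: continuous_comp; [exact: beta_map_continuous|exact: ck].
Qed.

End StoneCech.

Record one_point_ext (X : topologicalType) := OnePointExt {
  ope_space :> topologicalType;
  ope_in : X -> ope_space;
  ope_pt : ope_space;
  ope_tychonoff : tychonoff_space ope_space;
  ope_embedding : topological_embedding ope_in;
  ope_dense : dense (range ope_in);
  ope_remainder : ~` range ope_in = [set ope_pt] }.

Definition ope_equiv (X : topologicalType) (Y Z : one_point_ext X) :=
  exists2 h : Y -> Z, homeomorphism h & forall x, h (ope_in Y x) = ope_in Z x.

Lemma ope_in_continuous (X : topologicalType) (Y : one_point_ext X) :
  continuous (@ope_in X Y).
Proof. exact: topological_embedding_continuous (ope_embedding Y). Qed.

Definition ope_first_countable (X : topologicalType) (Y : one_point_ext X) :=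
  first_countable_at (ope_pt Y).

Section Mu.
Variables (R : realType) (X : topologicalType).
Implicit Types Y Z : one_point_ext X.

(* By beta_map_continuous, beta_map_in and beta_map_unique this is the unique
   continuous map from beta X to beta Y that is the identity on X. *)
Definition ope_beta Y : beta R X -> beta R Y :=
  beta_map (@ope_in_continuous X Y).

Definition mu Y : set (beta R X) := ope_beta Y @^-1` [set beta_in R (ope_pt Y)].

(* mu_equiv and ope_first_countable_equiv below say that mu and first
   countability at the added point depend only on the equivalence class of the
   extension; images under mu can hence be computed on representatives.
   The collection P is a bare predicate because one_point_ext X lives in too
   large a universe for the type set. *)
Definition mu_image (P : one_point_ext X -> Prop) : set (set (beta R X)) :=
  [set C | exists2 Y, P Y & mu Y = C].

Lemma ope_equiv_pt Y Z (h : Y -> Z) :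
  homeomorphism h -> (forall x, h (ope_in Y x) = ope_in Z x) ->
  h (ope_pt Y) = ope_pt Z.
Proof.
move=> [_ [g [_ hK gK]]] hin.
suff : (~` range (@ope_in X Z)) (h (ope_pt Y)) by rewrite ope_remainder.
move=> [x _]; rewrite -hin => /(congr1 g); rewrite !hK => xpt.
have : (~` range (@ope_in X Y)) (ope_pt Y) by rewrite ope_remainder.
by apply; exists x.
Qed.

Lemma ope_equiv_refl Y : ope_equiv Y Y.
Proof.
exists id => //; split=> [z|]; first exact: cvg_id.
by exists id; split => // z; exact: cvg_id.
Qed.

Lemma ope_equiv_sym Y Z : ope_equiv Y Z -> ope_equiv Z Y.
Proof.
move=> [h [ch [g [cg hK gK]]] hin]; exists g; first by split => //; exists h.
by move=> x; rewrite -hin hK.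
Qed.

Lemma ope_equiv_trans Y1 Y2 Y3 :
  ope_equiv Y1 Y2 -> ope_equiv Y2 Y3 -> ope_equiv Y1 Y3.
Proof.
move=> [h [ch [g [cg hK gK]]] hin] [h' [ch' [g' [cg' hK' gK']]] hin'].
exists (h' \o h); last by move=> x /=; rewrite hin.
split; first by move=> z; apply: continuous_comp; [exact: ch|exact: ch'].
exists (g \o g'); split; [|exact: can_comp|exact: can_comp].
by move=> z; apply: continuous_comp; [exact: cg'|exact: cg].
Qed.

Lemma ope_first_countable_equiv Y Z :
  ope_equiv Y Z -> ope_first_countable Y -> ope_first_countable Z.
Proof.
move=> [h hh hin] [B [cB Bp pB]]; have hpt := ope_equiv_pt hh hin.
have [ch [g [cg hK gK]]] := hh.
have gpt : g (ope_pt Z) = ope_pt Y by rewrite -hpt hK.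
exists [set g @^-1` V | V in B]; split.
- exact: card_le_trans (card_image_le _ _) cB.
- by move=> _ [V BV <-]; apply: cg; rewrite gpt; exact: Bp.
- move=> U nU; have [|V BV VU] := pB (h @^-1` U).
    by apply: ch; rewrite hpt.
  exists (g @^-1` V); first by exists V.
  by move=> z /VU /=; rewrite gK.
Qed.

Lemma mu_equiv Y Z : ope_equiv Y Z -> mu Y = mu Z.
Proof.
move=> [h hh hin]; have hpt := ope_equiv_pt hh hin.
have [ch [g [cg hK gK]]] := hh.
have bh : beta_map ch \o ope_beta Y = ope_beta Z.
  apply: (beta_map_unique (@ope_in_continuous X Z)).
    by move=> z; apply: continuous_comp; exact: beta_map_continuous.
  by move=> x /=; rewrite /ope_beta !beta_map_in hin.
have bK : beta_map cg \o beta_map ch = id :> (beta R Y -> beta R Y).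
  apply: (eq_continuous_dense (@beta_hausdorff R Y) (@beta_in_dense R Y)).
  - by move=> z; apply: continuous_comp; exact: beta_map_continuous.
  - by move=> z; exact: cvg_id.
  - by move=> x /=; rewrite !beta_map_in hK.
apply/seteqP; split => z; rewrite /mu /= -bh /= -hpt -(beta_map_in R ch).
  by move=> ->.
have bKz (w : beta R Y) : beta_map cg (beta_map ch w) = w.
  exact: (f_equal (fun k => k w) bK).
by move=> /(congr1 (beta_map cg)); rewrite !bKz.
Qed.

End Mu.

Arguments mu_image R {X} P.

(* Main.v *)
Require Import Defs.
From mathcomp Require Import all_boot all_order all_algebra.
From mathcomp Require Import all_classical all_reals all_analysis.

Import Order.TTheory GRing.Theory Num.Theory.
Import numFieldNormedType.Exports.

Local Open Scope classical_set_scope.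
Local Open Scope ring_scope.

(** Write F for the map from beta X to beta Y extending the inclusion of X in
    Y = X + {p}, so that mu Y is the fibre of F over p. Membership in that
    fibre is detected on X: since X is dense in beta X and beta Y is Hausdorff,
    a point z is in mu Y as soon as every neighbourhood of p in Y contains the
    trace on X of a neighbourhood of z ([mu_trace]).

    Suppose Y has a countable base (b n) at p. As Y is Tychonoff, some
    continuous phi n from Y to [0, 1] vanishes at p and equals 1 off b n.
    Extended to beta Y and pulled back along F, the functions phi n vanish on
    mu Y; conversely, at a common zero z of these pullbacks, the points of X
    near z satisfy phi n < 1, hence lie in b n, and [mu_trace] puts z in mu Y.
    So mu Y is a countable intersection of zero-sets, hence a zero-set
    ([mu_zero_set]). It is not empty because the range of F is compact and
    dense, and it misses X because F sends each point of X to itself.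

    Conversely, let C be the non-empty zero-set of f, where f maps beta X to
    [0, 1] and has no zero in X. The extension sought is the image of X and C
    in the quotient of beta X that collapses C to a point. Multiplying the
    embedding of beta X in its cube by f gives a continuous map to the same
    cube that sends exactly C to the origin and is injective off C; hence that
    quotient is realised inside the cube, and Y is X with the origin added,
    with the topology induced by the cube ([collapse_ext]). By compactness the
    sets {f < 1/(n+1)} form a base of neighbourhoods of C in beta X, which
    gives first countability at the origin. Finally f, extended by 0 at the
    origin, is continuous on Y, so it vanishes on mu Y; together with
    [mu_trace] this yields mu Y = C. *)

(** * Zero-sets *)

Lemma near_forall_ltn {T : topologicalType} (P : nat -> T -> Prop) (x : T)
    (N : nat) :
  (forall n, \forall y \near x, P n y) ->
  \forall y \near x, forall n, (n < N)%N -> P n y.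
Proof.
move=> nP; elim: N => [|N IHN]; first exact: nearW.
near=> y => n; rewrite ltnS leq_eqVlt => /predU1P[->|nN].
  by near: y; exact: nP.
by move: n nN; near: y.
Unshelve. all: by end_near. Qed.

(** After truncating the n-th function at 1/(n+1), only finitely many terms
    matter up to a given error, so the pointwise supremum of the family is
    continuous; it vanishes exactly where all the functions do. *)
Lemma zero_set_bigcap {R : realType} {T : topologicalType}
    (g : nat -> T -> R) :
  (forall n, continuous (g n)) -> zero_set R (\bigcap_n (g n @^-1` [set 0])).
Proof.
move=> cg; pose k n (x : T) : R := Num.min `|g n x| n.+1%:R^-1.
have k_ge0 n x : 0 <= k n x by rewrite le_min normr_ge0 invr_ge0 ler0n.
have k_le n x : k n x <= n.+1%:R^-1 by rewrite ge_min lexx orbT.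
have ck n : continuous (k n).
  move=> x; apply: (@continuous_min R T (fun y => `|g n y|) (cst n.+1%:R^-1)).
    by apply: continuous_comp; [exact: cg|exact: norm_continuous].
  exact: cst_continuous.
pose h x := sup (range (k^~ x)).
have k_ub x : has_ubound (range (k^~ x)).
  exists 1 => _ [n _ <-]; rewrite (le_trans (k_le n x))//.
  by rewrite invf_le1 ?ltr0n// ler1n.
have k_h n x : k n x <= h x by apply: ub_le_sup => //; exists n.
have h_le x r : (forall n, k n x <= r) -> h x <= r.
  by move=> kr; apply: ge_sup => [|_ [n _ <-]//]; exists (k 0%N x); exists 0%N.
have h_ge0 x : 0 <= h x := le_trans (k_ge0 0%N x) (k_h 0%N x).
exists h.
  move=> x; apply/cvgrPdist_le => e e0.
  have [N _ Ne] := near_infty_natSinv_lt (PosNum e0).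
  have : \forall y \near x, forall n, (n < N)%N -> `|k n x - k n y| <= e.
    by apply: near_forall_ltn => n; exact: (cvgrPdist_le _ _).1 (ck n x) _ e0.
  apply: filterS => y kxy; rewrite ler_distlC.
  have tail n z : (N <= n)%N -> k n z <= e.
    by move=> /Ne /= /ltW; exact: le_trans.
  apply/andP; split; [rewrite lerBlDr|]; apply: h_le => n.
    have [nN|Nn] := ltnP n N; last by rewrite (le_trans (tail _ _ Nn))// lerDr.
    have := kxy n nN; rewrite ler_distlC lerBlDr => /andP[+ _].
    by move=> /le_trans; apply; rewrite lerD2r.
  have [nN|Nn] := ltnP n N; last by rewrite (le_trans (tail _ _ Nn))// lerDr.
  have := kxy n nN; rewrite ler_distlC => /andP[_].
  by move=> /le_trans; apply; rewrite lerD2r.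
apply/seteqP; split => x /= gx.
  apply/eqP; rewrite eq_le h_ge0 andbT; apply: h_le => n.
  by rewrite /k (gx n I) normr0 ge_min lexx.
move=> n _ /=; have : k n x <= 0 by rewrite -gx.
by rewrite ge_min invr_le0 lern0 orbF normr_le0 => /eqP.
Qed.

Lemma zero_set_unit {R : realType} {T : topologicalType} (A : set T) :
  zero_set R A -> exists f : T -> R,
    [/\ continuous f, forall x, 0 <= f x <= 1 & A = f @^-1` [set 0]].
Proof.
move=> [f cf ->]; exists (fun x => Num.min `|f x| 1); split.
- move=> x; apply: (@continuous_min R T (fun y => `|f y|) (cst 1)).
    by apply: continuous_comp; [exact: cf|exact: norm_continuous].
  exact: cst_continuous.
- by move=> x; rewrite le_min normr_ge0 ler01 ge_min lexx orbT.
- apply/seteqP; split => x /= fx; first by rewrite fx normr0 min_l.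
  apply/eqP; rewrite -normr_eq0; move: fx; rewrite minElt.
  by case: ifP => _ /eqP//; rewrite oner_eq0.
Qed.

(** The image under f of the complement of V is compact and misses 0, so it
    stays at a positive distance from 0. *)
Lemma compact_zero_set_nbhs {R : realType} {T : topologicalType} (f : T -> R)
    (V : set T) :
  compact [set: T] -> continuous f -> open V -> f @^-1` [set 0] `<=` V ->
  exists n : nat, forall z, `|f z| < n.+1%:R^-1 -> V z.
Proof.
move=> cT cf oV f0V.
have cK : compact (~` V).
  by apply: subclosed_compact cT _ => //; exact: open_closedC.
have : closed (f @` (~` V)).
  apply: compact_closed; first exact: Rhausdorff.
  by apply: continuous_compact cK; exact: continuous_subspaceT.
move=> /closed_openC; rewrite openE => /(_ 0)[].
  by move=> [z nVz fz]; apply: nVz; exact: f0V.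
move=> e /= e0 eK.
have [n _ /(_ n (leqnn n)) /= ne] := near_infty_natSinv_lt (PosNum e0).
exists n => z fz; apply: contrapT => nVz.
apply: (eK (f z)) => /=; last by exists z.
by rewrite sub0r normrN (lt_trans fz).
Qed.

(** * Tychonoff spaces *)

Lemma locally_compact_tychonoff (R : realType) (X : topologicalType) :
  locally_compact [set: X] -> hausdorff_space X -> tychonoff_space X.
Proof.
by move=> lX hX; split => //; exact: (@locally_compact_completely_regular X R).
Qed.

Lemma cube_tychonoff (R : realType) (T : topologicalType) :
  tychonoff_space (cube R T).
Proof.
split; last exact: cube_hausdorff.
exact: (@uniform_completely_regular R (cube R T)).
Qed.

Lemma initial_tychonoff (R : realType) (S : choiceType) (U : topologicalType)
    (f : S -> U) :
  injective f -> tychonoff_space U -> tychonoff_space (initial_topology f).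
Proof.
move=> fI [crU hU]; split.
  move=> x B /closed_openC[A oA AB] nBx.
  have nAx : ~ (~` A) (f x).
    by apply; change ((f @^-1` A) x); rewrite AB.
  have /(@uniform_separatorP U R)[g [cg g01 gx gA]] :=
    crU _ _ (open_closedC oA) nAx.
  apply/(@uniform_separatorP _ R); exists (g \o f); split.
  - move=> y; apply: continuous_comp; last exact: cg.
    exact: (@initial_continuous S U f).
  - by move=> _ [y _ <-]; apply: g01; exists (f y).
  - by move=> _ [_ -> <-]; apply: gx; exists (f x).
  - move=> _ [y By <-]; apply: gA; exists (f y) => // Afy.
    by have : (~` B) y by rewrite -AB.
move=> x y xy; apply: fI; apply: hU => A B xA yB.
have nA : nbhs (x : initial_topology f) (f @^-1` A).
  exact: (@initial_continuous S U f).
have nB : nbhs (y : initial_topology f) (f @^-1` B).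
  exact: (@initial_continuous S U f).
by have [v [Av Bv]] := xy _ _ nA nB; exists (f v).
Qed.

(** Complete regularity in the form used to pass to beta T: the separating
    function is one of the coordinates of the cube containing beta T. *)
Lemma tychonoff_unit_function {R : realType} {T : topologicalType} (x : T)
    (B : set T) :
  tychonoff_space T -> nbhs x B ->
  exists i : unit_functions (R:=R) (T:=T),
    set_val i x = 0 /\ forall y, set_val i y < 1 -> B y.
Proof.
move=> [crT _]; rewrite nbhsE => -[A [oA Ax] AB].
have /(@uniform_separatorP T R)[f [cf f01 f0 f1]] :=
  crT _ _ (open_closedC oA) (fun nAx => nAx Ax).
have fP : f \in unit_functions (R:=R) (T:=T).
  apply/mem_set; split => // y.
  by have := f01 (f y); rewrite /= in_itv; apply; exists y.
exists (exist (fun g => g \in unit_functions (T:=T)) f fP); split.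
  by apply: f0; exists x.
move=> y fy; apply: AB; apply: contrapT => nAy.
by move: fy; rewrite [X in X < 1](f1 (f y)) ?ltxx//; exists y.
Qed.

(** * The fibre over the added point *)

Lemma nbhs_beta_in {R : realType} {T : topologicalType} (z : beta R T)
    (V : set (beta R T)) :
  nbhs z V -> exists x, V (beta_in R x).
Proof.
rewrite nbhsE => -[W [oW Wz] WV].
have [|_ [/[swap] -[x _ <-] Wx]] := @beta_in_dense R T W _ oW.
  by exists z.
by exists x; exact: WV.
Qed.

Section Fibre.
Context {R : realType} {X : topologicalType} (Y : one_point_ext X).

Lemma ope_in_neq_pt x : ope_in Y x <> ope_pt Y.
Proof.
move=> xp; have : (~` range (@ope_in X Y)) (ope_pt Y) by rewrite ope_remainder.
by apply; exists x.
Qed.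

(** If the image of z were not p, it would have a neighbourhood disjoint from
    one of p; but points of X close enough to z are sent into both. *)
Lemma mu_trace (z : beta R X) :
  (forall B, nbhs (ope_pt Y) B ->
     exists2 V, nbhs z V & forall x, V (beta_in R x) -> B (ope_in Y x)) ->
  mu Y z.
Proof.
move=> trace; apply: (@beta_hausdorff R Y) => A B zA pB.
have [|V zV VB] := trace (@beta_in R Y @^-1` B).
  exact: (@beta_in_continuous R Y).
have /nbhs_beta_in[x [Ax Vx]] : nbhs z (@ope_beta R X Y @^-1` A `&` V).
  by apply: filterI => //; exact: (@beta_map_continuous R X Y).
exists (beta_in R (ope_in Y x)); split; last exact: VB.
by move: Ax; rewrite /= /ope_beta beta_map_in.
Qed.

(** The left-hand side is the extension to beta X of the restriction to X of
    the function i on Y; it factors through beta Y, hence is constant on the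
    fibre over p. *)
Lemma mu_unit_function (i : unit_functions (R:=R) (T:=Y)) (z : beta R X) :
  mu Y z ->
  set_val z (pull (@ope_in_continuous X Y) i) = set_val i (ope_pt Y).
Proof. exact: (f_equal (fun w : beta R Y => set_val w i)). Qed.

Lemma mu_disjoint : mu Y `&` range (@beta_in R X) = set0.
Proof.
apply/seteqP; split => // z [+ [x _ xz]]; rewrite -xz /mu /= /ope_beta.
rewrite beta_map_in => /(@beta_in_embedding R Y (ope_tychonoff Y)).1.
exact: ope_in_neq_pt.
Qed.

(** The range of the extended map is closed, so if it missed p it would miss
    the image in beta Y of an open neighbourhood of p in Y; but that
    neighbourhood meets X. *)
Lemma mu_neq0 : mu (R:=R) Y <> set0.
Proof.
move=> mu0; pose K := range (@ope_beta R X Y).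
have cK : closed K.
  apply: compact_closed; first exact: beta_hausdorff.
  apply: continuous_compact; last exact: beta_compact.
  by apply: continuous_subspaceT; exact: beta_map_continuous.
have oK : open (@beta_in R Y @^-1` (~` K)).
  apply: open_comp; last exact: closed_openC.
  by move=> y _; exact: beta_in_continuous.
have Kp : (@beta_in R Y @^-1` (~` K)) (ope_pt Y).
  by move=> [z _ zp]; have : mu (R:=R) Y z by []; rewrite mu0.
have [_ [/[swap] -[x _ <-]]] := ope_dense (ex_intro _ _ Kp) oK.
by apply; exists (beta_in R x) => //; exact: beta_map_in.
Qed.

(** The zero-set is the set of common zeros of the extensions to beta X of
    functions separating p from the complements of the members of a countable
    base at p. *)
Lemma mu_zero_set : ope_first_countable Y -> zero_set R (mu (R:=R) Y).
Proof.
move=> [B [/pfcard_geP[B0|[b]] Bp pB]].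
  by have [V] := pB setT filterT; rewrite B0.
have bB n : B (b n) by exact: funS.
have sep n := tychonoff_unit_function (R:=R) _ _ (ope_tychonoff Y) (Bp _ (bB n)).
pose i n := projT1 (cid (sep n)).
have [ip ib] : (forall n, set_val (i n) (ope_pt Y) = 0) /\
    (forall n y, set_val (i n) y < 1 -> b n y).
  by split=> n; have [] := projT2 (cid (sep n)).
pose g n (z : beta R X) : R := set_val z (pull (@ope_in_continuous X Y) (i n)).
have cg n : continuous (g n) by exact: beta_coord_continuous.
suff -> : mu Y = \bigcap_n (g n @^-1` [set 0]) by exact: zero_set_bigcap.
apply/seteqP; split => z; first by move=> zp n _; rewrite /g /= mu_unit_function.
move=> gz; apply: mu_trace => U /pB[V BV VU].
have [n _ bnV] : range b V by exact: surj.
exists (g n @^-1` [set r | r < 1]).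
  apply: open_nbhs_nbhs; split.
    by apply: open_comp; [move=> ? _; exact: cg|exact: open_lt].
  by rewrite /= gz.
by move=> x xn; apply: VU; rewrite -bnV; exact: ib.
Qed.

End Fibre.

(** * Collapsing a zero-set to a point *)

Fact one_unit_subproof {R : realType} {T : topologicalType} :
  (cst 1 : T -> R) \in unit_functions (R:=R) (T:=T).
Proof.
by apply/mem_set; split=> [|x]; [exact: cst_continuous|rewrite ler01 lexx].
Qed.

(** The coordinate at the constant function 1 is the one that recovers f from
    the collapsing map below. *)
Definition one_unit {R : realType} {T : topologicalType} :
    unit_functions (R:=R) (T:=T) :=
  exist (fun g => g \in unit_functions (T:=T)) _ one_unit_subproof.

Lemma beta_one_unit {R : realType} {T : topologicalType} (z : beta R T) :
  set_val z one_unit = 1.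
Proof.
suff /(f_equal (fun g => g z)) :
  (fun z : beta R T => set_val z one_unit : R) = cst 1 by [].
apply: (eq_continuous_dense (@Rhausdorff R) (@beta_in_dense R T)) => //.
  exact: beta_coord_continuous.
exact: cst_continuous.
Qed.

Section Collapse.
Context {R : realType} {X : topologicalType} (f : beta R X -> R).

(** Identifies the zeros of f with one another, and nothing else: the image of
    beta X is the quotient of beta X by the zero-set of f. *)
Definition collapse (z : beta R X) : cube R X := fun i => f z * set_val z i.

Lemma collapse_one z : collapse z one_unit = f z.
Proof. by rewrite /collapse beta_one_unit mulr1. Qed.

Lemma collapse_eq0 z : collapse z = (fun=> 0) <-> f z = 0.
Proof.
split=> [z0|fz]; first by rewrite -collapse_one z0.
by apply/funext => i; rewrite /collapse fz mul0r.
Qed.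

Lemma collapse_inj z w : f z != 0 -> collapse z = collapse w -> z = w.
Proof.
move=> fz zw; have fzw : f z = f w by rewrite -!collapse_one zw.
apply: val_inj; apply/funext => i; apply: (mulfI fz).
by rewrite {2}fzw; exact: (f_equal (fun u => u i) zw).
Qed.

Lemma collapse_continuous : continuous f -> continuous collapse.
Proof.
move=> cf; apply: cube_continuous => i z.
by apply: continuousM; [exact: cf|exact: beta_coord_continuous].
Qed.

Definition collapse_in (y : option X) : cube R X :=
  if y is Some x then collapse (beta_in R x) else fun=> 0.

Definition collapse_space : topologicalType := initial_topology collapse_in.

Hypothesis cf : continuous f.
Hypothesis fX : forall x, f (beta_in R x) != 0.

Lemma collapse_in_inj : tychonoff_space X -> injective collapse_in.
Proof.
move=> tX [x|] [y|] //=.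
- by move=> /collapse_inj -/(_ (fX x)) /(@beta_in_embedding R X tX).1 ->.
- by move=> /collapse_eq0 x0; move: (fX x); rewrite x0 eqxx.
- by move=> /esym/collapse_eq0 y0; move: (fX y); rewrite y0 eqxx.
Qed.

Lemma collapse_space_tychonoff :
  tychonoff_space X -> tychonoff_space collapse_space.
Proof.
move=> tX; apply: (initial_tychonoff R); first exact: collapse_in_inj.
exact: cube_tychonoff.
Qed.

(** An open subset of X is the trace of an open B in beta X. The image of the
    complement of B is compact, hence closed in the cube, and by injectivity
    off the zero-set its complement cuts out B on X. *)
Lemma collapse_embedding :
  tychonoff_space X -> topological_embedding (Some : X -> collapse_space).
Proof.
move=> tX; split; first by move=> x y [].
move=> A; split=> [|[B [U oU <-] ->]]; last first.
  apply: (@open_comp _ _ (collapse \o @beta_in R X) U) => // x _.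
  apply: continuous_comp; first exact: beta_in_continuous.
  exact: collapse_continuous.
move=> /(@beta_in_embedding R X tX).2[B oB ->].
pose K := collapse @` (~` B).
have cK : closed K.
  apply: compact_closed; first exact: cube_hausdorff.
  apply: continuous_compact.
    by apply: continuous_subspaceT; exact: collapse_continuous.
  by apply: subclosed_compact (@beta_compact R X) _ => //; exact: open_closedC.
exists (collapse_in @^-1` (~` K)).
  by exists (~` K) => //; exact: closed_openC.
apply/seteqP; split=> x /= Bx.
  move=> [z nBz /esym zx]; apply: nBz.
  by rewrite -(collapse_inj _ _ (fX x) zx).
by apply: contrapT => nBx; apply: Bx; exists (beta_in R x).
Qed.

Lemma nbhs_collapse_None (B : set collapse_space) :
  nbhs (None : collapse_space) B ->
  exists V, [/\ open V, f @^-1` [set 0] `<=` V &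
    forall x, V (beta_in R x) -> B (Some x)].
Proof.
move=> [_ [[U oU <-] U0] UB]; exists (collapse @^-1` U); split.
- by apply: open_comp => // z _; exact: collapse_continuous.
- by move=> z /= /collapse_eq0 ->.
- by move=> x Ux; exact: UB.
Qed.

Hypothesis f0 : f @^-1` [set 0] !=set0.

Lemma collapse_dense : dense (range (Some : X -> collapse_space)).
Proof.
move=> A [[x|] Ax] oA; first by exists (Some x); split => //; exists x.
have [V [oV fV VA]] := nbhs_collapse_None _ (open_nbhs_nbhs (conj oA Ax)).
have [z fz] := f0.
have [x /VA ?] := nbhs_beta_in _ _ (open_nbhs_nbhs (conj oV (fV _ fz))).
by exists (Some x); split => //; exists x.
Qed.

Lemma collapse_remainder :
  ~` range (Some : X -> collapse_space) = [set None].
Proof.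
apply/seteqP; split=> [[x|]//|_ -> [x _]//].
by move=> nx; exfalso; apply: nx; exists x.
Qed.

Definition collapse_ext (tX : tychonoff_space X) : one_point_ext X :=
  OnePointExt (collapse_space_tychonoff tX) (collapse_embedding tX)
    collapse_dense collapse_remainder.

Lemma collapse_coord_continuous :
  continuous (fun y : collapse_space => collapse_in y one_unit).
Proof.
move=> y; apply: (@continuous_comp collapse_space (cube R X) R collapse_in
  (fun w => w one_unit)).
  exact: (@initial_continuous _ _ collapse_in).
exact: cube_proj_continuous.
Qed.

(** By compactness the sets where f < 1/(n+1) shrink to the zero-set of f, so
    their traces on X, with the added point, form a base there. *)
Lemma collapse_ext_first_countable (tX : tychonoff_space X) :
  ope_first_countable (collapse_ext tX).
Proof.
pose B n : set collapse_space :=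
  [set y | `|collapse_in y one_unit| < n.+1%:R^-1].
exists (range B); split.
- exact: card_image_le.
- move=> _ [n _ <-]; apply: open_nbhs_nbhs; split; last first.
    by rewrite /B /= normr0 invr_gt0 ltr0n.
  apply: (@open_comp _ _ (fun y : collapse_space => `|collapse_in y one_unit|)
    [set r | r < n.+1%:R^-1]); last exact: open_lt.
  move=> y _; apply: continuous_comp; first exact: collapse_coord_continuous.
  exact: norm_continuous.
- move=> U nU; have [V [oV fV VU]] := nbhs_collapse_None _ nU.
  have [n nV] := compact_zero_set_nbhs _ _ (@beta_compact R X) cf oV fV.
  exists (B n); first by exists n.
  move=> [x|] /=; last by move=> _; exact: nbhs_singleton nU.
  by rewrite /B /= collapse_one => /nV; exact: VU.
Qed.

(** On the fibre over the added point f vanishes because f, extended by 0, is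
    a continuous function on the extension; zeros of f are in the fibre by
    [mu_trace], as neighbourhoods of the added point come from neighbourhoods
    of the whole zero-set. *)
Lemma mu_collapse_ext (tX : tychonoff_space X) :
  (forall z, 0 <= f z <= 1) -> mu (collapse_ext tX) = f @^-1` [set 0].
Proof.
move=> f01; apply/seteqP; split=> z; last first.
  move=> fz; apply: mu_trace => B /nbhs_collapse_None[V [oV fV VB]].
  by exists V => //; apply: open_nbhs_nbhs; split => //; exact: fV.
(* f on X, and 0 at the added point *)
pose phi (y : collapse_ext tX) : R := collapse_in y one_unit.
have phiP : phi \in unit_functions (R:=R) (T:=collapse_ext tX).
  apply/mem_set; split; first exact: collapse_coord_continuous.
  by move=> [x|]; rewrite /phi /= ?collapse_one// lexx ler01.
pose i : unit_functions (R:=R) (T:=collapse_ext tX) :=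
  exist (fun g => g \in unit_functions (R:=R) (T:=collapse_ext tX)) phi phiP.
move=> /(mu_unit_function _ i) => iz.
suff fE : (fun w : beta R X =>
    set_val w (pull (@ope_in_continuous X (collapse_ext tX)) i) : R) = f.
  by rewrite /= -fE.
apply: (eq_continuous_dense (@Rhausdorff R) (@beta_in_dense R X)) => //.
  exact: beta_coord_continuous.
by move=> x; exact: collapse_one.
Qed.

End Collapse.

Theorem theorem2p9 (R : realType) (X : topologicalType)
    (X_locally_compact : locally_compact [set: X])
    (X_hausdorff : hausdorff_space X) :
  mu_image R (@ope_first_countable X) =
  [set C : set (beta R X) | zero_set R C /\ C `&` range (@beta_in R X) = set0]
    `\` [set set0].
Proof.
have tX := locally_compact_tychonoff R X X_locally_compact X_hausdorff.
apply/seteqP; split=> [_ [Y Y1 <-]|C [[/zero_set_unit[f [cf f01 ->]] fX] f0]].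
  split; last exact: mu_neq0.
  by split; [exact: mu_zero_set|exact: mu_disjoint].
have {}fX x : f (beta_in R x) != 0.
  apply/eqP => fx.
  have : (f @^-1` [set 0] `&` range (@beta_in R X)) (beta_in R x).
    by split => //; exists x.
  by rewrite fX.
have {}f0 : f @^-1` [set 0] !=set0 by exact/set0P/eqP.
exists (collapse_ext f cf fX f0 tX); first exact: collapse_ext_first_countable.
exact: mu_collapse_ext.
Qed.
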